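(* Let $R$ be a commutative noetherian ring, or a commutative ring of weak global dimension at most one. Then all minimal cosilting $R$-modules extend to minimal cosilting modules along any pseudoflat ring epimorphism; that is, for every minimal cosilting $R$-module $C$ and every pseudoflat ring epimorphism $\lambda':R\to S'$, the $S'$-module $\mathrm{Hom}_R(S',C)$ is a minimal cosilting $S'$-module.
   Context: A ring epimorphism $\lambda:R\to S$ (an epimorphism in the category of unital rings) is pseudoflat if $\mathrm{Tor}_1^R(S,S)=0$. If $R$ is commutative and $R\to S$ is a ring epimorphism, then $S$ is commutative. Fix a commutative ring $k$ such that $R$ is a $k$-algebra and an injective cogenerator $W$ of $\mathrm{Mod}\,k$ (for example $k=\mathbb Z$, $W=\mathbb Q/\mathbb Z$) and write $(-)^+=\mathrm{Hom}_k(-,W)$. The following definitions apply to any $k$-algebra $A$ (in particular $A=R$, $A=S'$), and to left modules. For a module $C$, $\mathrm{Prod}\,C$ is the class of direct summands of products of copies of $C$, $\mathrm{Cogen}\,C$ the class of submodules of products of copies of $C$, and ${}^{\perp_0}C=\{X\mid\mathrm{Hom}_A(X,C)=0\}$. $C$ is cosilting if it has an injective copresentation $0\to C\to Q_0\xrightarrow{\omega}Q_1$ (with $Q_0,Q_1$ injective) such that $\mathrm{Cogen}\,C=\{X\mid\mathrm{Hom}_A(X,\omega)\text{ is surjective}\}$. For a cosilting $A$-module $C$ there is an exact sequence $0\to C_1\to C_0\xrightarrow{g}A^+$ with $C_0,C_1\in\mathrm{Prod}\,C$ and $g$ a right $\mathrm{Prod}\,C$-approximation; $C$ is minimal cosilting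 if the sequence can be chosen such that $\mathrm{Cogen}\,C\cap{}^{\perp_0}C_1$ is bireflective (a full subcategory closed under products, coproducts, kernels and cokernels) and $\mathrm{Hom}_A(C_0,C_1)=0$. *)

(* Defs.v *)
From HB Require Import structures.
From mathcomp Require Import all_boot all_order all_algebra.
From mathcomp Require Import generic_quotient.
From mathcomp Require Import boolp functions.

Set Implicit Arguments.
Unset Strict Implicit.
Unset Printing Implicit Defensive.

Import GRing.Theory.

Local Open Scope ring_scope.
Local Open Scope quotient_scope.

(* Rings are [pzRingType]s, so the zero ring is allowed (it is, for instance,
   the target of a pseudoflat ring epimorphism out of any ring). *)

Definition onto (X Y : Type) (f : X -> Y) : Prop := forall y, exists x, f x = y.

Definition exact_at (X Y : Type) (Z : zmodType) (f : X -> Y) (g : Y -> Z) :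
  Prop := forall y, g y = 0 <-> exists x, f x = y.

Definition ring_epi (R S : pzRingType) (lam : {rmorphism R -> S}) : Prop :=
  forall (T : pzRingType) (f g : {rmorphism S -> T}),
    f \o lam =1 g \o lam -> f =1 g.

(** ** Modules along a ring homomorphism *)

(* A as a left B-module, b *: a = phi b * a. *)
Definition lres (B A : pzRingType) (phi : {rmorphism B -> A}) : Type := A.

Section LRes.
Context (B A : pzRingType) (phi : {rmorphism B -> A}).
HB.instance Definition _ := GRing.Zmodule.on (lres phi).

Definition lres_scale (b : B) (a : lres phi) : lres phi := phi b * (a : A).

Lemma lres_scaleA a b v :
  lres_scale a (lres_scale b v) = lres_scale (a * b) v.
Proof. by rewrite /lres_scale rmorphM mulrA. Qed.

Lemma lres_scale1 : left_id 1 lres_scale.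
Proof. by move=> v; rewrite /lres_scale rmorph1 mul1r. Qed.

Lemma lres_scaleDr : right_distributive lres_scale +%R.
Proof. by move=> a u v; rewrite /lres_scale mulrDr. Qed.

Lemma lres_scaleDl v : {morph lres_scale^~ v : a b / a + b}.
Proof. by move=> a b; rewrite /lres_scale rmorphD mulrDl. Qed.

HB.instance Definition _ := GRing.Zmodule_isLmodule.Build B (lres phi)
  lres_scaleA lres_scale1 lres_scaleDr lres_scaleDl.
End LRes.

(* A as a right B-module, a . b = a * phi b; since B is commutative this is
   again written as a left B-module. *)
Definition rres (B : comPzRingType) (A : pzRingType)
  (phi : {rmorphism B -> A}) : Type := A.

Section RRes.
Context (B : comPzRingType) (A : pzRingType) (phi : {rmorphism B -> A}).
HB.instance Definition _ := GRing.Zmodule.on (rres phi).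

Definition rres_scale (b : B) (a : rres phi) : rres phi := (a : A) * phi b.

Lemma rres_scaleA a b v :
  rres_scale a (rres_scale b v) = rres_scale (a * b) v.
Proof. by rewrite /rres_scale -mulrA -rmorphM (mulrC b). Qed.

Lemma rres_scale1 : left_id 1 rres_scale.
Proof. by move=> v; rewrite /rres_scale rmorph1 mulr1. Qed.

Lemma rres_scaleDr : right_distributive rres_scale +%R.
Proof. by move=> a u v; rewrite /rres_scale mulrDl. Qed.

Lemma rres_scaleDl v : {morph rres_scale^~ v : a b / a + b}.
Proof. by move=> a b; rewrite /rres_scale rmorphD mulrDr. Qed.

HB.instance Definition _ := GRing.Zmodule_isLmodule.Build B (rres phi)
  rres_scaleA rres_scale1 rres_scaleDr rres_scaleDl.
End RRes.

(* The left A-module Hom_B(A, M), with (a *: f) x = f (x * a). *)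
Section Coind.
Context (B A : pzRingType) (phi : {rmorphism B -> A}) (M : lmodType B).

Definition coind_pred : {pred A -> M} :=
  fun f => `[< linear (f : lres phi -> M) >].

Lemma coindP (f : A -> M) :
  reflect (linear (f : lres phi -> M)) (f \in coind_pred).
Proof. exact: asboolP. Qed.

Lemma coind_zmod_closed : zmod_closed coind_pred.
Proof.
split=> [|f g /coindP fl /coindP gl]; apply/coindP=> b x y.
  by rewrite scaler0 addr0.
change (f (b *: (x : lres phi) + y) - g (b *: (x : lres phi) + y) =
  b *: (f x - g x) + (f y - g y)).
by rewrite fl gl scalerBr opprD addrACA.
Qed.

HB.instance Definition _ := GRing.isZmodClosed.Build _ coind_pred
  coind_zmod_closed.

Record coind : Type :=
  Coind { coind_val :> A -> M; _ : coind_val \in coind_pred }.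

HB.instance Definition _ := [isSub for coind_val].
HB.instance Definition _ := [Choice of coind by <:].
HB.instance Definition _ := [SubChoice_isSubZmodule of coind by <:].

Fact coind_scale_subproof (a : A) (f : coind) :
  (fun x => f (x * a)) \in coind_pred.
Proof.
apply/coindP=> b x y; have /coindP fl := valP f.
change (f ((phi b * x + y) * a) = b *: f (x * a) + f (y * a)).
rewrite mulrDl -mulrA; exact: fl.
Qed.

Definition coind_scale (a : A) (f : coind) : coind :=
  Coind (coind_scale_subproof a f).

Lemma coind_scaleA a b f :
  coind_scale a (coind_scale b f) = coind_scale (a * b) f.
Proof. by apply/val_inj/funext=> x /=; rewrite mulrA. Qed.

Lemma coind_scale1 : left_id 1 coind_scale.
Proof. by move=> f; apply/val_inj/funext=> x /=; rewrite mulr1. Qed.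

Lemma coind_scaleDr : right_distributive coind_scale +%R.
Proof. by move=> a f g; apply/val_inj/funext=> x. Qed.

Lemma coind_scaleDl f : {morph coind_scale^~ f : a b / a + b}.
Proof.
move=> a b; apply/val_inj/funext=> x; have /coindP fl := valP f.
change (f (x * (a + b)) = f (x * a) + f (x * b)).
rewrite mulrDr; have := fl 1 (x * a) (x * b).
by rewrite scale1r [1 *: _]scale1r.
Qed.

HB.instance Definition _ := GRing.Zmodule_isLmodule.Build A coind
  coind_scaleA coind_scale1 coind_scaleDr coind_scaleDl.
End Coind.

(** ** Minimal cosilting modules *)

Section Modules.
Context (A : pzRingType).
Implicit Types (C X Q P : lmodType A).

Definition injective_module Q : Prop :=
  forall (X Y : lmodType A) (i : {linear X -> Y}) (f : {linear X -> Q}),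
    injective i -> exists g : {linear Y -> Q}, g \o i =1 f.

Definition projective_module P : Prop :=
  forall (X Y : lmodType A) (p : {linear X -> Y}) (f : {linear P -> Y}),
    onto p -> exists g : {linear P -> X}, p \o g =1 f.

Definition inProd C X : Prop :=
  exists (I : Type) (i : {linear X -> (I -> C)}) (p : {linear (I -> C) -> X}),
    cancel i p.

Definition inCogen C X : Prop :=
  exists (I : Type) (i : {linear X -> (I -> C)}), injective i.

Definition hom_zero X C : Prop := forall f : {linear X -> C}, f =1 \0.

Definition injective_cogenerator C : Prop :=
  injective_module C /\ forall X, inCogen C X.

Definition cosilting C : Prop :=
  exists (Q0 Q1 : lmodType A) (i : {linear C -> Q0}) (om : {linear Q0 -> Q1}),
    [/\ injective_module Q0, injective_module Q1,
        injective i, exact_at i om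
      & forall X, inCogen C X <->
          forall f : {linear X -> Q1}, exists g : {linear X -> Q0}, om \o g =1 f].

Definition is_product (I : Type) (M : I -> lmodType A) P
    (p : forall i, {linear P -> M i}) : Prop :=
  forall m : (forall i, M i), exists! x : P, forall i, p i x = m i.

Definition is_coproduct (I : Type) (M : I -> lmodType A) P
    (j : forall i, {linear M i -> P}) : Prop :=
  forall X (f : forall i, {linear M i -> X}),
    exists h : {linear P -> X}, (forall i, h \o j i =1 f i) /\
      forall h' : {linear P -> X}, (forall i, h' \o j i =1 f i) -> h' =1 h.

(* Products, coproducts, kernels and cokernels are given up to isomorphism, so
   that such a class is in particular closed under isomorphism. *)
Definition bireflective (XX : lmodType A -> Prop) : Prop :=
  [/\ forall (I : Type) (M : I -> lmodType A) P (p : forall i, {linear P -> M i}),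
        (forall i, XX (M i)) -> is_product p -> XX P,
      forall (I : Type) (M : I -> lmodType A) P (j : forall i, {linear M i -> P}),
        (forall i, XX (M i)) -> is_coproduct j -> XX P,
      forall (X Y K : lmodType A) (f : {linear X -> Y}) (i : {linear K -> X}),
        XX X -> XX Y -> injective i -> exact_at i f -> XX K
    & forall (X Y Q : lmodType A) (f : {linear X -> Y}) (q : {linear Y -> Q}),
        XX X -> XX Y -> onto q -> exact_at f q -> XX Q].

Definition right_Prod_approx C (C0 D : lmodType A) (g : {linear C0 -> D}) :
  Prop :=
  inProd C C0 /\
  forall X (f : {linear X -> D}),
    inProd C X -> exists h : {linear X -> C0}, g \o h =1 f.

End Modules.

(* A is a k-algebra via kap, and [coind kap W] is A^+ = Hom_k(A, W). *)
Definition minimal_cosilting (k A : pzRingType) (kap : {rmorphism k -> A})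
    (W : lmodType k) (C : lmodType A) : Prop :=
  cosilting C /\
  exists (C1 C0 : lmodType A) (i : {linear C1 -> C0})
         (g : {linear C0 -> coind kap W}),
    [/\ inProd C C1 /\ right_Prod_approx C g,
        injective i, exact_at i g,
        bireflective (fun X => inCogen C X /\ hom_zero X C1)
      & hom_zero C0 C1].

(** ** Tensor products and Tor over a commutative ring *)

Definition bilinear_map (R : comPzRingType) (M N P : lmodType R)
    (b : M -> N -> P) : Prop :=
  (forall n, linear (b^~ n)) /\ (forall m, linear (b m)).

(* Elements are formal sums of pairs (m, n); two formal sums are identified when
   no bilinear map separates them, i.e. when they agree in M (x)_R N. The
   universal property is proved in [tens_bilinear], [tlift_tens] and [tlift_uniq] below. *)
Section Tensor.
Context (R : comPzRingType) (M N : lmodType R).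

Definition bsum (P : lmodType R) (b : M -> N -> P) (s : seq (M * N)) : P :=
  \sum_(x <- s) b x.1 x.2.

Definition teq : rel (seq (M * N)) := fun s t =>
  `[< forall (P : lmodType R) (b : M -> N -> P),
        bilinear_map b -> bsum b s = bsum b t >].

Fact teq_refl : reflexive teq. Proof. by move=> s; apply/asboolP. Qed.
Fact teq_sym : symmetric teq.
Proof. by move=> s t; apply/asboolP/asboolP=> H P b /H. Qed.
Fact teq_trans : transitive teq.
Proof.
by move=> t s u /asboolP H /asboolP K; apply/asboolP=> P b Hb; rewrite H ?K.
Qed.

Canonical teq_equiv := EquivRel teq teq_refl teq_sym teq_trans.

Definition tensor : Type := {eq_quot teq}.
HB.instance Definition _ := Choice.on tensor.
HB.instance Definition _ : EqQuotient _ teq tensor := EqQuotient.on tensor.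

Definition bsum_tensor (P : lmodType R) (b : M -> N -> P) (t : tensor) : P :=
  bsum b (repr t).

Lemma bsum_pi (P : lmodType R) (b : M -> N -> P) s :
  bilinear_map b -> bsum_tensor b (\pi_tensor s) = bsum b s.
Proof.
move=> Hb; have /eqmodP/asboolP := reprK (\pi_tensor s).
exact.
Qed.

Lemma tensor_ext (t u : tensor) :
  (forall (P : lmodType R) (b : M -> N -> P),
     bilinear_map b -> bsum_tensor b t = bsum_tensor b u) -> t = u.
Proof.
by move=> H; rewrite -[t]reprK -[u]reprK; apply/eqmodP/asboolP=> P b /H.
Qed.

Definition t0 : tensor := \pi_tensor [::].
Definition tadd (t u : tensor) : tensor := \pi_tensor (repr t ++ repr u).
Definition tscale (r : R) (t : tensor) : tensor :=
  \pi_tensor [seq (r *: x.1, x.2) | x <- repr t].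
Definition topp (t : tensor) : tensor := tscale (-1) t.

Lemma bsum0 (P : lmodType R) (b : M -> N -> P) :
  bilinear_map b -> bsum_tensor b t0 = 0.
Proof. by move=> Hb; rewrite bsum_pi // /bsum big_nil. Qed.

Lemma bsumD (P : lmodType R) (b : M -> N -> P) t u : bilinear_map b ->
  bsum_tensor b (tadd t u) = bsum_tensor b t + bsum_tensor b u.
Proof. by move=> Hb; rewrite bsum_pi // /bsum big_cat. Qed.

Lemma bsumZ (P : lmodType R) (b : M -> N -> P) r t : bilinear_map b ->
  bsum_tensor b (tscale r t) = r *: bsum_tensor b t.
Proof.
move=> Hb; rewrite bsum_pi // /bsum big_map scaler_sumr.
apply: eq_bigr => x _ /=; have b0 : b 0 x.2 = 0.
  have := Hb.1 x.2 1 0 0; rewrite !scale1r addr0 => /eqP.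
  by rewrite -subr_eq subrr => /eqP.
by have := Hb.1 x.2 r x.1 0; rewrite addr0 b0 addr0.
Qed.

Lemma taddA : associative tadd.
Proof. by move=> x y z; apply: tensor_ext => P b Hb; rewrite !bsumD ?addrA. Qed.
Lemma taddC : commutative tadd.
Proof. by move=> x y; apply: tensor_ext => P b Hb; rewrite !bsumD // addrC. Qed.
Lemma tadd0 : left_id t0 tadd.
Proof. by move=> x; apply: tensor_ext => P b Hb; rewrite bsumD ?bsum0 ?add0r. Qed.
Lemma taddN : left_inverse t0 topp tadd.
Proof.
move=> x; apply: tensor_ext => P b Hb.
by rewrite bsumD ?bsumZ ?bsum0 // scaleN1r addNr.
Qed.

HB.instance Definition _ := GRing.isZmodule.Build tensor taddA taddC tadd0 taddN.

Lemma tscaleA a b v : tscale a (tscale b v) = tscale (a * b) v.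
Proof. by apply: tensor_ext => P f Hf; rewrite !bsumZ ?scalerA. Qed.
Lemma tscale1 : left_id 1 tscale.
Proof. by move=> v; apply: tensor_ext => P f Hf; rewrite bsumZ ?scale1r. Qed.
Lemma tscaleDr : right_distributive tscale +%R.
Proof.
move=> a u v; apply: tensor_ext => P f Hf.
by rewrite bsumZ // !bsumD // !bsumZ // scalerDr.
Qed.
Lemma tscaleDl v : {morph tscale^~ v : a b / a + b}.
Proof.
move=> a b; apply: tensor_ext => P f Hf.
by rewrite bsumD // !bsumZ // scalerDl.
Qed.

HB.instance Definition _ := GRing.Zmodule_isLmodule.Build R tensor
  tscaleA tscale1 tscaleDr tscaleDl.

Definition tens (m : M) (n : N) : tensor := \pi_tensor [:: (m, n)].

Lemma bsum_tens (P : lmodType R) (b : M -> N -> P) m n :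
  bilinear_map b -> bsum_tensor b (tens m n) = b m n.
Proof. by move=> Hb; rewrite bsum_pi // /bsum big_seq1. Qed.

Lemma tens_bilinear : bilinear_map tens.
Proof.
split=> [n | m] r x y; apply: tensor_ext => P b Hb.
  by rewrite bsumD // bsumZ // !bsum_tens //; apply: (Hb.1 n).
by rewrite bsumD // bsumZ // !bsum_tens //; apply: (Hb.2 m).
Qed.

Section Lift.
Context (P : lmodType R) (b : M -> N -> P) (Hb : bilinear_map b).

Definition tlift of bilinear_map b := bsum_tensor b.

Fact tlift_linear : linear (tlift Hb).
Proof. by move=> r t u; rewrite /tlift -bsumZ // -bsumD. Qed.

HB.instance Definition _ :=
  GRing.isLinear.Build R tensor P *:%R (tlift Hb) tlift_linear.

Lemma tlift_tens m n : tlift Hb (tens m n) = b m n.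
Proof. exact: bsum_tens. Qed.

Lemma tlift_uniq (h : {linear tensor -> P}) :
  (forall m n, h (tens m n) = b m n) -> h =1 tlift Hb.
Proof.
move=> hE t; rewrite -[t]reprK; elim: (repr t) => [|[m n] s IHs].
  by have -> : \pi_tensor [::] = 0 :> tensor by []; rewrite !linear0.
suff -> : \pi_tensor ((m, n) :: s) = tens m n + \pi_tensor s :> tensor.
  by rewrite !linearD /= IHs hE tlift_tens.
apply: tensor_ext => Q c Hc.
by rewrite bsumD // !bsum_pi // /bsum big_cons big_seq1.
Qed.
End Lift.
End Tensor.

Section TensorMap.
Context (R : comPzRingType) (M M' N : lmodType R) (f : {linear M -> M'}).

Fact tmap_bilinear : bilinear_map (fun (m : M) (n : N) => tens (f m) n).
Proof.
have [H1 H2] := tens_bilinear M' N.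
by split=> [n | m] r x y; rewrite ?linearP; [apply: H1 | apply: H2].
Qed.

(* f (x) N *)
Definition tmap : {linear tensor M N -> tensor M' N} := tlift tmap_bilinear.
End TensorMap.

Record proj_resolution (R : pzRingType) (M : lmodType R) := ProjResolution {
  pres_obj : nat -> lmodType R;
  pres_d : forall n, {linear pres_obj n.+1 -> pres_obj n};
  pres_aug : {linear pres_obj 0%N -> M};
  pres_proj : forall n, projective_module (pres_obj n);
  pres_onto : onto pres_aug;
  pres_exact0 : exact_at (pres_d 0%N) pres_aug;
  pres_exact : forall n, exact_at (pres_d n.+1) (pres_d n)
}.

(* Tor_n^R(M, N) = 0: the n-th homology of P (x)_R N vanishes, P being a
   projective resolution of M. *)
Definition Tor_eq0 (R : comPzRingType) (n : nat) (M N : lmodType R) : Prop :=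
  exists P : proj_resolution M,
    match n with
    | 0 => onto (tmap N (pres_d P 0%N))
    | m.+1 => exact_at (tmap N (pres_d P m.+1)) (tmap N (pres_d P m))
    end.

Definition wgldim_le (R : comPzRingType) (d : nat) : Prop :=
  forall n (M N : lmodType R), (d < n)%N -> Tor_eq0 n M N.

Definition pseudoflat (R : comPzRingType) (S : pzRingType)
    (lam : {rmorphism R -> S}) : Prop := Tor_eq0 1%N (rres lam) (lres lam).

Definition noetherian (R : comPzRingType) : Prop :=
  forall I : {pred R^o}, submod_closed I ->
    exists (n : nat) (a : 'I_n -> R), forall x : R,
      x \in I <-> exists c : 'I_n -> R, x = \sum_(i < n) c i * a i.

(* Main.v *)
Require Import Defs.
From HB Require Import structures.
From mathcomp Require Import all_boot all_order all_algebra.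
From mathcomp Require Import boolp functions.

Set Implicit Arguments.
Unset Strict Implicit.
Unset Printing Implicit Defensive.

Import GRing.Theory.

Local Open Scope ring_scope.

(** Coinduction [coind lam = Hom_R(S', -)] is right adjoint to restriction of
    scalars, which is exact; so coinduction preserves kernels, products, direct
    summands and injective modules.  Applied to an injective copresentation of C it gives one of
    [coind lam C], and an S'-module is cogenerated by [coind lam C] exactly when
    its restriction is cogenerated by C; hence [coind lam C] is cosilting.

    Applied to the sequence [0 -> C1 -> C0 -> R^+] of the minimal cosilting
    module C, and using that [Hom_R(S', R^+)] is [S'^+], it gives the sequence
    required over S'.
    - Its last map is an approximation: a map to [S'^+] from a summand of a
      power of [coind lam C] corresponds to an R-linear map to [R^+] from a
      module cogenerated by C, and as [R^+] is injective that map extends to a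
      power of C and so factors through C0
      ([right_Prod_approx_injective]).
    - By adjunction, the class attached to the new sequence consists of the
      S'-modules whose restriction lies in the class
      [YY = Cogen C /\ perp C1] attached to the old one, and
      bireflectivity passes to such a preimage because restriction preserves
      products, coproducts, kernels and cokernels ([bireflective_res]).
    - Maps from [coind lam C0] to [coind lam C1] correspond to R-linear maps
      from [Hom_R(S', C0)] to C1.  The module C0 lies in YY, since it
      is cogenerated by C and has no nonzero map to C1.  Being R-linear is a
      system of linear equations on functions from S' to C0, so [Hom_R(S', C0)]
      is the kernel of a map between powers of C0 and lies in YY too
      ([bireflective_coind]); in particular it has no nonzero map to C1.

    Comparing the R-module [Hom_R(S', M)] with the power of M indexed by S'
    requires the image of R in S' to be central.  This is where the epimorphism
    enters: two conjugate embeddings of S' into 2 x 2 matrices agree on R, hence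
    on S' ([epi_commute], [epi_central]). *)

(** * Linear maps, powers and restriction of scalars *)

Section LinearMaps.
Context (B : pzRingType).
Implicit Types U V : lmodType B.

Definition mklin U V (f : U -> V) (lf : linear f) : {linear U -> V} :=
  HB.pack f (GRing.isLinear.Build B U V *:%R f lf).

Lemma eval_linear (I : Type) V (i : I) : linear (fun u : I -> V => u i).
Proof. by []. Qed.

Definition eval (I : Type) V (i : I) : {linear (I -> V) -> V} :=
  mklin (@eval_linear I V i).

Lemma pointwise_linear (I : Type) U V (f : I -> {linear U -> V}) :
  linear (fun x i => f i x : V).
Proof. by move=> r x y; apply/funext=> i /=; rewrite linearP. Qed.

Definition pointwise (I : Type) U V (f : I -> {linear U -> V}) :
    {linear U -> (I -> V)} :=
  mklin (pointwise_linear f).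

Lemma power_is_product (I : Type) V :
  is_product (M := fun _ : I => V) (fun i => eval V i).
Proof. by move=> m; exists m; split=> // u um; apply/funext=> i; exact/esym/um. Qed.

End LinearMaps.

(** The B-module structure depends on [phi], which is therefore part of the
    type although the carrier ignores it. *)
Definition res (B A : pzRingType) (phi : {rmorphism B -> A})
  (X : lmodType A) : Type := X.

Section Restriction.
Context (B A : pzRingType) (phi : {rmorphism B -> A}).

Section Module.
Context (X : lmodType A).
HB.instance Definition _ := GRing.Zmodule.on (res phi X).

Definition res_scale (b : B) (x : res phi X) : res phi X := phi b *: (x : X).

Lemma res_scaleA a b v : res_scale a (res_scale b v) = res_scale (a * b) v.
Proof. by rewrite /res_scale rmorphM scalerA. Qed.
Lemma res_scale1 : left_id 1 res_scale.
Proof. by move=> v; rewrite /res_scale rmorph1 scale1r. Qed.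
Lemma res_scaleDr : right_distributive res_scale +%R.
Proof. by move=> a u v; rewrite /res_scale scalerDr. Qed.
Lemma res_scaleDl v : {morph res_scale^~ v : a b / a + b}.
Proof. by move=> a b; rewrite /res_scale rmorphD scalerDl. Qed.

HB.instance Definition _ := GRing.Zmodule_isLmodule.Build B (res phi X)
  res_scaleA res_scale1 res_scaleDr res_scaleDl.
End Module.

Lemma res_map_linear (X Y : lmodType A) (f : {linear X -> Y}) :
  linear (f : res phi X -> res phi Y).
Proof. by move=> r x y; exact: linearP. Qed.

Definition res_map (X Y : lmodType A) (f : {linear X -> Y}) :
    {linear res phi X -> res phi Y} :=
  mklin (res_map_linear f).

(** * Coinduction is right adjoint to restriction *)

Lemma coindL (M : lmodType B) (h : coind phi M) b x y :
  h (phi b * x + y) = b *: h x + h y.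
Proof. by have /coindP := valP h; apply. Qed.

Lemma coindZ (M : lmodType B) (h : coind phi M) b x :
  h (phi b * x) = b *: h x.
Proof.
have h0 : h 0 = 0.
  by have := coindL h (-1) 0 0; rewrite mulr0 addr0 scaleN1r addNr.
by have := coindL h b x 0; rewrite !addr0 h0 addr0.
Qed.

Lemma coind_ext (M : lmodType B) (h h' : coind phi M) : h =1 h' -> h = h'.
Proof. by move=> e; apply/val_inj/funext. Qed.

Lemma ev1_linear (M : lmodType B) : linear (fun h : res phi (coind phi M) => h 1).
Proof.
move=> b h h'; rewrite -[b *: h 1]coindZ mulr1 -[phi b in RHS]mul1r.
by [].
Qed.

Definition ev1 (M : lmodType B) : {linear res phi (coind phi M) -> M} :=
  mklin (@ev1_linear M).

Section Transpose.
Context (X : lmodType A) (M : lmodType B) (f : {linear res phi X -> M}).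

Fact transpose_subproof (x : X) : (fun a => f (a *: x)) \in coind_pred phi (M:=M).
Proof.
apply/coindP=> b a a' /=.
by rewrite -linearP; congr (f _); rewrite scalerDl -scalerA.
Qed.

Lemma transpose_linear : linear (fun x => Coind (transpose_subproof x)).
Proof.
move=> a x y; apply: coind_ext => s /=.
rewrite scalerDr scalerA; exact: (linearD f (_ : res phi X)).
Qed.

Definition transpose : {linear X -> coind phi M} := mklin transpose_linear.

End Transpose.

Definition untranspose (X : lmodType A) (M : lmodType B)
  (F : {linear X -> coind phi M}) : {linear res phi X -> M} := ev1 M \o res_map F.

Lemma transposeK (X : lmodType A) (M : lmodType B)
  (F : {linear X -> coind phi M}) : transpose (untranspose F) =1 F.
Proof. by move=> x; apply: coind_ext => s /=; rewrite linearZ /= mul1r. Qed.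

Lemma untransposeK (X : lmodType A) (M : lmodType B)
  (f : {linear res phi X -> M}) : untranspose (transpose f) =1 f.
Proof. by move=> x /=; rewrite scale1r. Qed.

Definition coind_map (M N : lmodType B) (u : {linear M -> N}) :
    {linear coind phi M -> coind phi N} := transpose (u \o ev1 M).

Lemma coind_mapE (M N : lmodType B) (u : {linear M -> N}) h a :
  coind_map u h a = u (h a).
Proof. by rewrite /= mul1r. Qed.

Lemma hom_zero_coind (X : lmodType A) (M : lmodType B) :
  hom_zero X (coind phi M) <-> hom_zero (res phi X) M.
Proof.
split=> H f x.
  rewrite -untransposeK.
  exact: (congr1 (fun h : coind phi M => h 1) (H (transpose f) x)).
by rewrite -transposeK; apply: coind_ext => a; exact: H.
Qed.

(** The lifting condition that describes Cogen of a cosilting module is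
    invariant under adjunction. *)
Lemma coind_lift (M N : lmodType B) (u : {linear M -> N}) (X : lmodType A) :
  (forall f : {linear X -> coind phi N},
     exists g : {linear X -> coind phi M}, coind_map u \o g =1 f) <->
  (forall f : {linear res phi X -> N},
     exists g : {linear res phi X -> M}, u \o g =1 f).
Proof.
split=> H f.
  have [g ge] := H (transpose f); exists (untranspose g) => x.
  by rewrite -[f x]untransposeK -[RHS]/(transpose f x 1) -ge /= mul1r.
have [g ge] := H (untranspose f); exists (transpose g) => x.
apply: coind_ext => a; rewrite -[f x]transposeK; rewrite [LHS]coind_mapE.
exact: ge.
Qed.

Lemma coind_injective_module (Q : lmodType B) :
  injective_module Q -> injective_module (coind phi Q).
Proof.
move=> injQ X Y i f inj_i.
have [g ge] := injQ _ _ (res_map i) (untranspose f) inj_i.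
exists (transpose g) => x; apply: coind_ext => a.
by rewrite -[f x]transposeK /= -linearZ; exact: ge.
Qed.

Lemma coind_map_inj (M N : lmodType B) (u : {linear M -> N}) :
  injective u -> injective (coind_map u).
Proof.
move=> inj_u h h' e; apply: coind_ext => a; apply: inj_u.
by rewrite -!coind_mapE e.
Qed.

(** A function with values in the image of [i] lifts pointwise, and the lift is
    linear because [i] is injective. *)
Lemma coind_exact (L M N : lmodType B) (i : {linear L -> M})
    (u : {linear M -> N}) :
  injective i -> exact_at i u -> exact_at (coind_map i) (coind_map u).
Proof.
move=> inj_i ex y; split=> [y0 | [x <-]]; last first.
  by apply: coind_ext => a; rewrite !coind_mapE; apply/ex; exists (x a).
have im a : exists x, i x = y a by apply/ex; rewrite -coind_mapE y0.
have [x xE] := choice im.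
have xl : x \in coind_pred phi (M:=L).
  by apply/coindP=> b a a'; apply: inj_i; rewrite linearP !xE; exact: coindL.
by exists (Coind xl); apply: coind_ext => a; rewrite coind_mapE xE.
Qed.

Lemma inProd_coind (C X : lmodType B) :
  inProd C X -> inProd (coind phi C) (coind phi X).
Proof.
move=> [I [i [p pK]]].
exists I, (pointwise (fun j => coind_map (eval C j \o i))).
exists (transpose (p \o pointwise (fun j => ev1 C \o res_map (eval _ j)))).
move=> h; apply: coind_ext => a /=; rewrite -[RHS]pK; congr (p _).
by apply/funext=> j /=; rewrite !mul1r.
Qed.

Lemma res_is_product (I : Type) (M : I -> lmodType A) (P : lmodType A)
    (p : forall i, {linear P -> M i}) :
  is_product p -> is_product (fun i => res_map (p i)).
Proof. by []. Qed.

(** Restriction is also a left adjoint, of [coind]: cocones on the restricted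
    family are transposed, and the mediating map is transposed back. *)
Lemma res_is_coproduct (I : Type) (M : I -> lmodType A) (P : lmodType A)
    (j : forall i, {linear M i -> P}) :
  is_coproduct j -> is_coproduct (fun i => res_map (j i)).
Proof.
move=> copr X f.
have [h [hj huniq]] := copr _ (fun i => transpose (f i)).
exists (untranspose h); split=> [i x | h' h'j x].
  by rewrite -[f i x]untransposeK -[RHS]/(transpose (f i) x 1) -hj.
rewrite -[h' x]untransposeK /= -(huniq (transpose h')) // => i {}x.
by apply: coind_ext => a /=; rewrite -linearZ; exact: h'j.
Qed.

Lemma bireflective_res (YY : lmodType B -> Prop) :
  bireflective YY -> bireflective (fun X => YY (res phi X)).
Proof.
move=> [YP YC YK YQ]; split.
- by move=> I M P p YM /res_is_product; exact: YP.
- by move=> I M P j YM /res_is_coproduct; exact: YC.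
- move=> X Y K f i; exact: (YK _ _ _ (res_map f) (res_map i)).
- move=> X Y Q f q; exact: (YQ _ _ _ (res_map f) (res_map q)).
Qed.

Section Central.
Hypothesis phiC : forall b a, phi b * a = a * phi b.

(** B acts on [coind phi M] by multiplying the argument on the right, whereas
    maps in [coind phi M] are linear for the multiplication on the left; the two
    agree for a central image. *)
Lemma forget_linear (M : lmodType B) :
  linear (fun (h : res phi (coind phi M)) (a : A) => h a).
Proof.
move=> b h h'; apply/funext=> a.
by rewrite -[RHS]/(b *: h a + h' a) -coindZ phiC.
Qed.

Definition forget (M : lmodType B) : {linear res phi (coind phi M) -> (A -> M)} :=
  mklin (@forget_linear M).

(** An embedding of the restriction of X in a power of C transposes to one of X
    in a power of [coind phi C]; conversely [coind phi C] itself embeds, by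
    [forget], in a power of C. *)
Lemma inCogen_coind (C : lmodType B) (X : lmodType A) :
  inCogen (coind phi C) X <-> inCogen C (res phi X).
Proof.
split=> -[I [i inj_i]].
  exists (I * A)%type.
  exists (pointwise (fun ja => eval C ja.2 \o forget C \o
                               res_map (eval _ ja.1 \o i))).
  move=> x y e; apply: inj_i; apply/funext=> j; apply: coind_ext => a.
  exact: (congr1 (@^~ (j, a)) e).
exists I, (pointwise (fun j => transpose (eval C j \o i))).
move=> x y e; apply: inj_i; apply/funext=> j.
by have := congr1 (fun u : I -> coind phi C => u j 1) e; rewrite /= !scale1r.
Qed.

Lemma cosilting_coind (C : lmodType B) : cosilting C -> cosilting (coind phi C).
Proof.
move=> [Q0 [Q1 [i [om [inj0 inj1 inj_i ex cog]]]]].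
exists (coind phi Q0), (coind phi Q1), (coind_map i), (coind_map om); split.
- exact: coind_injective_module.
- exact: coind_injective_module.
- exact: coind_map_inj.
- exact: coind_exact.
- by move=> X; rewrite inCogen_coind coind_lift.
Qed.

End Central.
End Restriction.
Arguments forget {B A phi}.

(** * The coinduced module as a kernel between powers *)

Section Kernel.
Context (R : comPzRingType) (S : pzRingType) (phi : {rmorphism R -> S}).
Hypothesis phiC : forall r s, phi r * s = s * phi r.

Section Defect.
Context (M : lmodType R) (w : R * S * S).

(** These maps, with [w] running over [R * S * S], are the equations that cut
    [coind phi M] out of the power [S -> M]; R has to be commutative for the
    scaling by [w.1.1] to be R-linear. *)
Definition linearity_defect_fun (u : S -> M) : M :=
  u (phi w.1.1 * w.1.2 + w.2) - (w.1.1 *: u w.1.2 + u w.2).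

Lemma linearity_defect_linear : linear linearity_defect_fun.
Proof.
move=> r u v; rewrite /linearity_defect_fun; case: w => -[b s] t /=.
rewrite -[LHS]/(r *: u (phi b * s + t) + v (phi b * s + t) -
  (b *: (r *: u s + v s) + (r *: u t + v t))).
rewrite [b *: (_ + _)]scalerDr scalerA (mulrC b) -scalerA addrACA -scalerDr.
by rewrite opprD addrACA -scalerBr.
Qed.

Definition linearity_defect : {linear (S -> M) -> M} :=
  mklin linearity_defect_linear.
End Defect.

Lemma forget_exact (M : lmodType R) :
  exact_at (forget phiC M) (pointwise (linearity_defect M)).
Proof.
move=> u; split=> [u0 | [h <-]]; last first.
  by apply/funext=> w; rewrite /= /linearity_defect_fun /= coindL subrr.
have ul : u \in coind_pred phi (M:=M).
  apply/coindP=> r s t; apply/eqP; rewrite -subr_eq0; apply/eqP.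
  exact: (congr1 (fun f : R * S * S -> M => f (r, s, t)) u0).
by exists (Coind ul).
Qed.

(** By [forget_exact], [coind phi M] is a kernel of a map between powers of M. *)
Lemma bireflective_coind (YY : lmodType R -> Prop) (M : lmodType R) :
  bireflective YY -> YY M -> YY (res phi (coind phi M)).
Proof.
move=> [YP _ YK _] YM.
have Ypower I : YY (I -> M).
  exact: (YP I (fun=> M) _ _ (fun=> YM) (@power_is_product _ I M)).
apply: (YK _ _ _ (pointwise (linearity_defect M)) (forget phiC M)).
- exact: Ypower.
- exact: Ypower.
- move=> h h' e; apply: coind_ext => s.
  exact: (congr1 (fun f : S -> M => f s) e).
- exact: forget_exact.
Qed.

End Kernel.

(** * Targets of ring epimorphisms *)

Section Epi.
Context (R S : pzRingType) (lam : {rmorphism R -> S}).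
Hypothesis lam_epi : ring_epi lam.

Section Conj.
Context (T : pzRingType) (f : {rmorphism S -> T}) (p q : T).
Hypotheses (pq : p * q = 1) (qp : q * p = 1).

Definition conj_by (s : S) : T := p * f s * q.

Lemma conj_by_zmod : zmod_morphism conj_by.
Proof. by move=> s t; rewrite /conj_by rmorphB mulrBr mulrBl. Qed.

Lemma conj_by_monoid : monoid_morphism conj_by.
Proof.
split=> [|s t]; first by rewrite /conj_by rmorph1 mulr1.
by rewrite /conj_by rmorphM -!mulrA [q * (p * _)]mulrA qp mul1r.
Qed.

HB.instance Definition _ := GRing.isZmodMorphism.Build S T conj_by conj_by_zmod.
HB.instance Definition _ :=
  GRing.isMonoidMorphism.Build S T conj_by conj_by_monoid.

(** If [p] commutes with the image of R, then conjugating [f] by [p] changes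
    nothing on R, and an epimorphism forces it to change nothing on S. *)
Lemma epi_commute_unit :
  (forall r, p * f (lam r) = f (lam r) * p) -> forall s, p * f s = f s * p.
Proof.
move=> pC s.
have e : conj_by \o lam =1 f \o lam.
  by move=> r; rewrite /= /conj_by pC -mulrA pq mulr1.
by rewrite -[in RHS](lam_epi e) /= /conj_by -!mulrA qp mulr1.
Qed.
End Conj.

Definition corner (x : S) : 'M[S]_2 :=
  \matrix_(i, j) (x *+ ((i == ord0) && (j == ord_max))).

Lemma corner_nil x y : corner x * corner y = 0.
Proof.
apply/matrixP=> i j; rewrite !mxE !big_ord_recl big_ord0 !mxE /=.
by rewrite andbF mulr0n mul0r mulr0 !addr0.
Qed.

Lemma corner_scalar x s : corner x * s%:M = corner (x * s).
Proof.
apply/matrixP=> i j; rewrite !mxE !big_ord_recl big_ord0 !mxE /=.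
rewrite andbF mulr0n mul0r addr0 add0r !andbT.
by rewrite mulrnAl mulrnAr -mulrnA mulnC mulnb; case: j => [[|[]]].
Qed.

Lemma scalar_corner x s : s%:M * corner x = corner (s * x).
Proof.
by rewrite -[LHS]/(s%:M *m _) mul_scalar_mx; apply/matrixP=> i j;
   rewrite !mxE mulrnAr.
Qed.

(** The element x need not be a unit, but [1 + corner x] is one, as [corner x]
    squares to zero; and it commutes with a scalar matrix exactly when x
    commutes with the scalar. *)
Lemma epi_commute (x : S) :
  (forall r, x * lam r = lam r * x) -> forall s, x * s = s * x.
Proof.
move=> xC s.
have pq : (1 + corner x) * (1 - corner x) = 1.
  by rewrite mulrBr mulr1 mulrDl mul1r corner_nil addr0 addrK.
have qp : (1 - corner x) * (1 + corner x) = 1.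
  by rewrite mulrBl mul1r mulrDr mulr1 corner_nil addr0 addrK.
have := @epi_commute_unit _ (@scalar_mx S 2) _ _ pq qp.
rewrite /= => /(_ _ s) H.
have {H} : (1 + corner x) * s%:M = s%:M * (1 + corner x).
  apply: H => r.
  by rewrite mulrDl mul1r mulrDr mulr1 corner_scalar scalar_corner xC.
rewrite mulrDl mul1r mulrDr mulr1 corner_scalar scalar_corner => /addrI.
by move/matrixP/(_ ord0 ord_max); rewrite !mxE.
Qed.
End Epi.

Lemma epi_central (R : comPzRingType) (S : pzRingType)
    (lam : {rmorphism R -> S}) :
  ring_epi lam -> forall r s, lam r * s = s * lam r.
Proof.
by move=> epi r; apply: epi_commute epi _ _ => r'; rewrite -!rmorphM mulrC.
Qed.

(** * Character modules *)

Section Dual.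
Context (k R S : pzRingType) (kap : {rmorphism k -> R}).
Context (lam : {rmorphism R -> S}) (W : lmodType k).

Lemma ev1_ev1_linear :
  linear (fun F : res (lam \o kap) (coind lam (coind kap W)) => F 1 1).
Proof.
move=> c F G; suff e : F (1 * lam (kap c)) 1 = c *: (F 1 1 : W).
  by rewrite -[LHS]/(F (1 * lam (kap c)) 1 + G 1 1) e.
rewrite mul1r -[lam (kap c)]mulr1 coindZ -[LHS]/(F 1 (1 * kap c)).
by rewrite mul1r -[kap c]mulr1 coindZ.
Qed.

(** The natural isomorphism between [Hom_R(S, Hom_k(R, W))] and [Hom_k(S, W)],
    that is, between [Hom_R(S, R^+)] and [S^+]. *)
Definition coind_comp :
    {linear coind lam (coind kap W) ->
            coind (lam \o kap : {rmorphism _ -> _}) W} :=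
  transpose (mklin ev1_ev1_linear).

Lemma coind_compE F s : coind_comp F s = F s 1.
Proof. by rewrite /= mul1r. Qed.

Lemma coind_comp_inj : injective coind_comp.
Proof.
move=> F G e; apply: coind_ext => s; apply: coind_ext => r.
rewrite -[r]mul1r -[F s _]/((r *: F s) 1) -[G s _]/((r *: G s) 1).
by rewrite -!coindZ -!coind_compE e.
Qed.

(** The R-linear map to [R^+] corresponding to an S-linear map to [S^+]; it is
    determined by its values at 1, being the transpose of a map to W. *)
Lemma transpose_comp (X : lmodType S)
    (f : {linear X -> coind (lam \o kap : {rmorphism _ -> _}) W}) :
  exists fR : {linear res lam X -> coind kap W}, forall x, fR x 1 = f x 1.
Proof.
have fl : linear (untranspose f : res kap (res lam X) -> W).
  by move=> c x y; exact: (linearP (untranspose f)).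
by exists (transpose (mklin fl)) => x /=; rewrite scale1r.
Qed.
End Dual.

Lemma inCogen_inProd (B : pzRingType) (C X : lmodType B) :
  inProd C X -> inCogen C X.
Proof. by move=> [I [i [p ipK]]]; exists I, i; exact: can_inj ipK. Qed.

Lemma inProd_power (B : pzRingType) (I : Type) (C : lmodType B) :
  inProd C (I -> C).
Proof.
have il : linear (@id (I -> C)) by [].
by exists I, (mklin il), (mklin il).
Qed.

(** A map from X to an injective module extends to a power of C containing X,
    and powers of C are in Prod C. *)
Lemma right_Prod_approx_injective (B : pzRingType) (C C0 E X : lmodType B)
    (g : {linear C0 -> E}) (f : {linear X -> E}) :
  injective_module E -> right_Prod_approx C g -> inCogen C X ->
  exists h : {linear X -> C0}, g \o h =1 f.
Proof.
move=> injE [_ gapp] [I [j inj_j]].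
have [e ej] := injE _ _ j f inj_j.
have [h he] := gapp _ e (inProd_power I C).
by exists (h \o j) => x; rewrite -ej; exact: he.
Qed.

Lemma minimal_cosilting_coind (k : pzRingType) (W : lmodType k)
    (R : comPzRingType) (kap : {rmorphism k -> R}) (C : lmodType R)
    (S : pzRingType) (lam : {rmorphism R -> S}) :
  injective_module W -> (forall r s, lam r * s = s * lam r) ->
  minimal_cosilting kap W C ->
  minimal_cosilting (lam \o kap : {rmorphism k -> S}) W (coind lam C).
Proof.
move=> injW lamC [cosC [C1 [C0 [i [g [[PC1 gapp] inj_i ex_ig bir C01]]]]]].
have [PC0 _] := gapp.
split; first exact: cosilting_coind.
exists (coind lam C1), (coind lam C0), (coind_map lam i).
exists (coind_comp kap lam W \o coind_map lam g); split.
- split; first exact: inProd_coind.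
  split=> [|X f /inCogen_inProd /(inCogen_coind lamC) CX].
    exact: inProd_coind.
  have [fR fRE] := transpose_comp f.
  have [h gh] := right_Prod_approx_injective fR
                   (coind_injective_module (phi:=kap) injW) gapp CX.
  exists (transpose h) => x; apply: coind_ext => s.
  rewrite -[LHS]/(coind_comp kap lam W _ s) coind_compE coind_mapE.
  rewrite -[transpose h x s]/(h (s *: x)) -[g _]/((g \o h) (s *: x)) gh fRE.
  by rewrite linearZ /= mul1r.
- exact: coind_map_inj.
- move=> y; rewrite -(coind_exact inj_i ex_ig y).
  rewrite -[X in X = 0 <-> _]/(coind_comp kap lam W (coind_map lam g y)).
  split=> [e | ->]; last exact: linear0.
  by apply: (@coind_comp_inj _ _ _ kap lam W); rewrite linear0.
- have := bireflective_res lam bir; congr bireflective.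
  by apply/funext=> X; apply/propext; rewrite inCogen_coind // hom_zero_coind.
- apply/hom_zero_coind.
  have C0Y : inCogen C C0 /\ hom_zero C0 C1 by split; first exact: inCogen_inProd.
  exact: (bireflective_coind lamC bir C0Y).2.
Qed.

Theorem corollary4p11
  (k : comPzRingType) (W : lmodType k) (hW : injective_cogenerator W)
  (R : comPzRingType) (kap : {rmorphism k -> R})
  (hR : noetherian R \/ wgldim_le R 1%N)
  (C : lmodType R) (hC : minimal_cosilting kap W C)
  (S' : pzRingType) (lam : {rmorphism R -> S'})
  (hepi : ring_epi lam) (hpf : pseudoflat lam) :
  minimal_cosilting (lam \o kap : {rmorphism k -> S'}) W (coind lam C).
Proof. exact: minimal_cosilting_coind hW.1 (epi_central hepi) hC. Qed.
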